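(* Let $\varphi\in[0,\pi/2]$, let $I\subseteq\mathbb{R}$ be an open set which is $\varphi$-invex with respect to $\eta:I\times I\to\mathbb{R}$, and let $a,b\in I$ with $\eta(b,a)>0$. Let $f:I\to\mathbb{R}$ be differentiable with $f'\in L_1[a,a+e^{i\varphi}\eta(b,a)]$, let $\alpha>0$, $q>1$ and $\frac1p+\frac1q=1$. Suppose $|f'|^{q}$ is $h_\varphi$-preinvex on $I$ (with respect to $\varphi$ and $\eta$). Put $c=e^{i\varphi}\eta(b,a)$. Then $$\left|f(a)+f(a+c)-\frac{\Gamma(\alpha+1)}{c^{\alpha}}\left[J_{a^+}^{\alpha}f(a+c)+J_{(a+c)^-}^{\alpha}f(a)\right]\right|\le \left(\frac{2}{\alpha+1}\right)^{\frac1p}\left[1-\frac{1}{2^{\alpha}}\right]^{\frac1p}c\left\{\left[|f'(a)|^{\frac{p}{p-1}}+|f'(b)|^{\frac{p}{p-1}}\right]\int_0^1\left|(1-t)^{\alpha}-t^{\alpha}\right|h(t)\,dt\right\}^{\frac{p-1}{p}} .$$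
   Context: A set $I\subseteq\mathbb{R}$ is $\varphi$-invex with respect to $\eta:I\times I\to\mathbb{R}$ if $u+te^{i\varphi}\eta(v,u)\in I$ for all $u,v\in I$, $t\in[0,1]$; here $\varphi\in[0,\pi/2]$ is fixed. In particular, since $I\subseteq\mathbb{R}$, the number $e^{i\varphi}\eta(b,a)$ is real. Let $h:J\to\mathbb{R}$ be a nonnegative function, $[0,1]\subseteq J\subseteq\mathbb{R}$, for which the integral on the right-hand side exists as a finite Lebesgue integral. A function $g:I\to\mathbb{R}$ is $h_\varphi$-preinvex (with respect to $\varphi,\eta$) if $g(u+te^{i\varphi}\eta(v,u))\le h(1-t)g(u)+h(t)g(v)$ for all $u,v\in I$, $t\in[0,1]$. Riemann–Liouville fractional integrals of order $\alpha>0$: $J_{r^+}^{\alpha}f(x)=\frac{1}{\Gamma(\alpha)}\int_r^x(x-t)^{\alpha-1}f(t)\,dt$ for $x>r$, and $J_{r^-}^{\alpha}f(x)=\frac{1}{\Gamma(\alpha)}\int_x^r(t-x)^{\alpha-1}f(t)\,dt$ for $x<r$. *)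

(* Defs.v *)
From HB Require Import structures.
From mathcomp Require Import all_boot all_order all_algebra.
From mathcomp Require Import all_classical all_reals all_analysis.
From mathcomp Require Import complex.

Set Implicit Arguments.
Unset Strict Implicit.
Unset Printing Implicit Defensive.

Import Order.TTheory GRing.Theory Num.Theory.
Import numFieldNormedType.Exports.

Local Open Scope ring_scope.
Local Open Scope complex_scope.
Local Open Scope classical_set_scope.

(* e^{i phi}, by Euler's formula *)
Definition expi (R : realType) (phi : R) : R[i] := cos phi +i* sin phi.

(* u + t e^{i phi} eta(v, u), a priori a complex number *)
Definition phi_path (R : realType) (phi : R) (eta : R -> R -> R)
    (u v t : R) : R[i] :=
  u%:C + t%:C * expi phi * (eta v u)%:C.

(* Functions with domain I (or I x I) are encoded as total functions on R
   (or R x R), of which only the values on I (or I x I) are constrained. *)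

Definition phi_invex (R : realType) (phi : R) (eta : R -> R -> R)
    (I : set R) : Prop :=
  forall u v t : R, I u -> I v -> 0 <= t <= 1 ->
    exists2 w : R, I w & phi_path phi eta u v t = w%:C.

(* w is the real number u + t e^{i phi} eta(v, u), the argument of g; it exists
   (and lies in I) when I is phi-invex. *)
Definition h_phi_preinvex (R : realType) (phi : R) (eta : R -> R -> R)
    (h : R -> R) (I : set R) (g : R -> R) : Prop :=
  forall u v t w : R, I u -> I v -> 0 <= t <= 1 ->
    phi_path phi eta u v t = w%:C ->
    g w <= h (1 - t) * g u + h t * g v.

Definition Gamma (R : realType) (x : R) : R :=
  \int[@lebesgue_measure R]_(t in `]0, +oo[) (t `^ (x - 1) * expR (- t)).

(* J_{r^+}^alpha f (x), meant for r < x *)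
Definition RL_plus (R : realType) (alpha r : R) (f : R -> R) (x : R) : R :=
  (Gamma alpha)^-1 *
  \int[@lebesgue_measure R]_(t in `[r, x]) ((x - t) `^ (alpha - 1) * f t).

(* J_{r^-}^alpha f (x), meant for x < r *)
Definition RL_minus (R : realType) (alpha r : R) (f : R -> R) (x : R) : R :=
  (Gamma alpha)^-1 *
  \int[@lebesgue_measure R]_(t in `[x, r]) ((t - x) `^ (alpha - 1) * f t).

(* Main.v *)
(* The imaginary part of the equation for c forces sin phi = 0, so that
   c = eta b a > 0 and the segment [a, a + c] lies in I.  Put
   W t = (t - a)^alpha - (a + c - t)^alpha.  Integrating the derivative of W f
   over [a, a + c] and using Gamma (alpha + 1) = alpha * Gamma alpha, the
   quantity to be estimated is c^-alpha times the integral of W f'.  Hoelder's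
   inequality with weight |W|, the value 2 / (alpha + 1) * (1 - 2^-alpha) of the
   integral of |(1 - t)^alpha - t^alpha| over [0, 1], preinvexity and the
   symmetry t -> 1 - t give the bound.

   As f' is only assumed integrable, the first step rests on the fundamental
   theorem of calculus for everywhere differentiable functions with integrable
   derivative. *)

Require Import Defs.
From HB Require Import structures.
From mathcomp Require Import all_boot all_order all_algebra.
From mathcomp Require Import all_classical all_reals all_analysis.
From mathcomp Require Import complex.
From mathcomp Require Import measurable_realfun ring lra.

Set Implicit Arguments.
Unset Strict Implicit.
Unset Printing Implicit Defensive.

Import Order.TTheory GRing.Theory Num.Theory.
Import numFieldNormedType.Exports.

Local Open Scope ring_scope.
Local Open Scope complex_scope.
Local Open Scope classical_set_scope.

(** * Differentiable functions with integrable derivative *)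

(** A derivative that is merely integrable may be unbounded near every point of a large set, and
    absolute continuity of its primitive is not known beforehand. The way around is a majorant of
    the derivative's absolute value: near each point it stays above a constant that strictly exceeds
    the value there, and its integral is only slightly larger. Differentiability at a point then
    bounds the increments over short intervals around that point, and a supremum argument glues
    these bounds together. The resulting fundamental theorem asks only for one-sided continuity at
    the two ends. This matters because powers with exponent between 0 and 1 have no finite
    derivative at 0; they occur in [W] and in the primitives used for [Gamma]. [Gamma] is a bare
    integral over a half-line, so its finiteness, functional equation and positivity are all
    obtained from truncated integrals. On the side of [h], measurability is known only for its
    product with the kernel. The reflection t -> 1 - t is therefore applied to that whole product,
    the kernel being symmetric. *)

(** A form of compactness of the segment. The local clause concerns intervals that contain the point
    [z], because differentiability at [z] controls exactly such increments. The points reachable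
    from [a] have a supremum, which is itself reachable and could be passed if it were below [b]. *)
Lemma segment_additive_ind (R : realType) (a b : R) (P : R -> R -> Prop) :
  a <= b ->
  (forall x y z, a <= x -> x <= y -> y <= z -> z <= b ->
    P x y -> P y z -> P x z) ->
  (forall z, a <= z <= b -> exists2 e : R, 0 < e &
    forall x y, a <= x -> x <= z -> z <= y -> y <= b ->
      z - e < x -> y < z + e -> P x y) ->
  P a b.
Proof.
move=> ab Ptrans Ploc.
pose S := [set x | a <= x <= b /\ P a x].
have Sa : S a.
  split; first by rewrite lexx.
  have [|e e0] := Ploc a; first by rewrite lexx.
  by apply => //; rewrite ?lexx// ?ltrBlDr ltrDl.
have Sub : ubound S b by move=> x [/andP[]].
have hS : has_sup S by split; [exists a|exists b].
have aS : a <= sup S by apply: ub_le_sup => //; exists b.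
have Sb : sup S <= b by apply: ge_sup => //; exists a.
have [|e e0 Pe] := Ploc (sup S); first by rewrite aS Sb.
have [x [/andP[ax xb] Pax] xS] := sup_adherent e0 hS.
have xsup : x <= sup S by apply: ub_le_sup; [exists b|split => //; rewrite ax].
(* Half of the radius keeps [y] inside the window around the supremum. As [y] is reachable, it
   cannot exceed the supremum, so the minimum has to be [b]. *)
pose y := Num.min b (sup S + e / 2).
have yb : y <= b by rewrite ge_min lexx.
have Sy : sup S <= y by rewrite le_min Sb lerDl divr_ge0// ltW.
have Pay : P a y.
  apply: (Ptrans a x y) => //; first exact: le_trans xsup Sy.
  apply: Pe => //.
  by rewrite gt_min; apply/orP; right; rewrite ltrD2l gtr_pMr// invf_lt1 ?ltr1n.
have ySup : y <= sup S.
  by apply: ub_le_sup; [exists b|split => //; rewrite (le_trans aS Sy)].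
have [bs|sb] := leP b (sup S + e / 2).
  by move: Pay; rewrite /y (min_idPl bs).
by move: ySup; rewrite /y (min_idPr (ltW sb)) leNgt ltrDl divr_gt0.
Qed.

(* The last clause stands for lower semicontinuity of [u] together with
   [g < u] on [E]. *)
Lemma vitali_caratheodory (R : realType) (E : set R) (g : R -> R) (e : R) :
  measurable E -> (@lebesgue_measure R E < +oo)%E ->
  measurable_fun E g -> (forall x, E x -> 0 <= g x) -> 0 < e ->
  exists u : R -> \bar R, [/\ measurable_fun [set: R] u,
    forall x, (0 <= u x)%E,
    (\int[lebesgue_measure]_(x in E) u x <=
       \int[lebesgue_measure]_(x in E) (g x)%:E + e%:E)%E &
    forall x, E x -> exists U k, [/\ open U, U x, g x < k &
      forall y, U y -> (k%:E <= u y)%E]].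
Proof.
set mu := @lebesgue_measure R.
move=> mE muE mg g0 e0.
have muEfin : mu E \is a fin_num by rewrite ge0_fin_numE.
pose m := fine (mu E).
have m0 : 0 <= m by exact: fine_ge0.
(* Rounding up costs at most [d * m], hence at most half of [e]; the added 1 avoids a division by
   zero when [E] is null. *)
pose d := e / 2 / (m + 1).
have m10 : 0 < m + 1 by rewrite ltr_wpDl.
have d0 : 0 < d by rewrite !divr_gt0.
(* [g] is rounded up to the multiple [n.+1%:R * d] on the level set [A n],
   which is then enlarged to an open set [U n]. *)
pose A n := E `&` g @^-1` `[n%:R * d, n.+1%:R * d[.
have mA n : measurable (A n) by apply: mg => //; exact: measurable_itv.
have AE n : A n `<=` E by move=> x [].
have muA n : (mu (A n) < +oo)%E.
  apply: le_lt_trans muE; apply: le_measure; rewrite ?inE//.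
  exact: mA.
have Acov : \bigcup_n A n = E.
  apply/seteqP; split=> [x [n _ []]//|x Ex].
  have gd : 0 <= g x / d by rewrite divr_ge0 ?g0// ltW.
  exists (Num.truncn (g x / d)) => //; split => //=.
  have /andP[h1 h2] := truncn_itv gd.
  by rewrite in_itv/= -ler_pdivlMr// h1 -ltr_pdivrMr.
have Atriv : trivIset setT A.
  apply/trivIsetP => i j _ _ ij; apply/seteqP; split=> // x [[Ex +] [_ +]].
  rewrite /= !in_itv/= => /andP[i1 i2] /andP[j1 j2].
  have := le_lt_trans i1 j2; have := le_lt_trans j1 i2.
  rewrite !ltr_pM2r// !ltr_nat !ltnS => ji ij'.
  by move: ij; rewrite eqn_leq ji ij'.
have nd0 n : 0 < n.+1%:R * d by rewrite mulr_gt0.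
(* The tolerance is divided by the height on [U n], so that the excess of [U n] over [A n]
   contributes at most [e / 2 / 2 ^ n.+1]. These amounts sum to the other half of [e]. *)
pose en n : R := e / 2 / (2 ^ n.+1)%:R / (n.+1%:R * d).
have en0 n : 0 < en n by rewrite !divr_gt0// ltr0n expn_gt0.
have /choice[U HU] n : exists U : set R,
    [/\ open U, A n `<=` U & (mu (U `\` A n) < (en n)%:E)%E].
  exact: lebesgue_regularity_outer.
have oU n : open (U n) by have [] := HU n.
have mU n : measurable (U n) by exact: open_measurable.
pose v n (x : R) : \bar R := ((n.+1%:R * d) * \1_(U n) x)%:E.
have v0 n x : (0 <= v n x)%E by rewrite lee_fin mulr_ge0// ltW.
have mv n : measurable_fun [set: R] (v n).
  by apply/measurable_EFinP/measurable_funM.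
exists (fun x => \sum_(n <oo) v n x)%E; split.
- by apply: ge0_emeasurable_sum => // n x _ _.
- by move=> x; exact: nneseries_ge0.
- rewrite integral_nneseries//; last first.
    by move=> n; apply: measurable_funTS; exact: mv.
  apply: (@le_trans _ _ (\sum_(n <oo)
      (\int[mu]_(x in A n) (g x + d)%:E + (e / 2 / (2 ^ n.+1)%:R)%:E))%E).
    apply: lee_nneseries => [n _ _|n _]; first exact: integral_ge0.
    rewrite /v; under [X in (X <= _)%E]eq_integral do rewrite EFinM.
    rewrite ge0_integralZl//; last 2 first.
    + apply/measurable_EFinP; apply: measurable_indic; exact: mU.
    + by rewrite lee_fin ltW.
    rewrite integral_indic//; last exact: mU.
    have Usub : U n `&` E `<=` A n `|` (U n `\` A n).
      by move=> x [Ux _]; have [|] := pselect (A n x); [left|right].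
    apply: (@le_trans _ _ ((n.+1%:R * d)%:E * (mu (A n) + (en n)%:E))%E).
      rewrite lee_wpmul2l ?lee_fin ?(ltW (nd0 n))//.
      apply: (@le_trans _ _ (mu (A n `|` (U n `\` A n)))).
        apply: le_measure; rewrite ?inE//.
          by apply: measurableI; [exact: mU|exact: mE].
        by apply: measurableU; [exact: mA|exact: measurableD (mU n) (mA n)].
      apply: le_trans (@measureU2 _ _ _ lebesgue_measure _ _ (mA n) _) _.
        exact: measurableD (mU n) (mA n).
      by rewrite leeD2l//; have [_ _ /ltW] := HU n.
    rewrite ge0_muleDr//; last by rewrite lee_fin ltW.
    apply: leeD; last by rewrite -EFinM lee_fin /en mulrC divfK// gt_eqF.
    rewrite -integral_cst//; last exact: mA.
    apply: ge0_le_integral => //.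
    + exact: mA.
    + by move=> x _; rewrite /= lee_fin ltW.
    + apply/measurable_EFinP/measurable_funD => //.
      by apply: measurable_funS mg => //; exact: AE.
    + move=> x [Ex]; rewrite /= in_itv/= => /andP[+ _].
      by rewrite lee_fin -natr1 mulrDl mul1r lerD2r.
  apply: (le_trans (epsilon_trick _ _ _)).
  + move=> n; apply: integral_ge0 => x [Ex _].
    by rewrite lee_fin addr_ge0 ?g0// ltW.
  + by rewrite divr_ge0// ltW.
  have mgd : measurable_fun E (fun x => (g x + d)%:E).
    by apply/measurable_EFinP/measurable_funD.
  have -> : (\sum_(0 <= n <oo) \int[mu]_(x in A n) (g x + d)%:E)%E =
      (\int[mu]_(x in E) (g x + d)%:E)%E.
    rewrite -[in RHS]Acov ge0_integral_bigcup//= Acov//.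
    by move=> x Ex; rewrite lee_fin addr_ge0 ?g0// ltW.
  under eq_integral do rewrite EFinD.
  rewrite ge0_integralD//; last 2 first.
  + exact/measurable_EFinP.
  + by move=> x _; rewrite lee_fin ltW.
  rewrite -addeA leeD2l// integral_cst//.
  rewrite [X in (d%:E * X)%E](_ : _ = m%:E); last by rewrite fineK.
  rewrite -EFinM -EFinD lee_fin.
  rewrite [leRHS](splitr e) lerD2r /d mulrAC ler_pdivrMr//.
  by rewrite ler_wpM2l ?divr_ge0 ?(ltW e0)// lerDl.
- move=> x; rewrite -{1}Acov => -[n _ Anx].
  exists (U n), (n.+1%:R * d); split => //.
  + by have [_ + _] := HU n; exact.
  + by case: Anx => _; rewrite /= in_itv/= => /andP[].
  + move=> y Uy; rewrite (nneseries_split 0 n.+1)//.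
    rewrite add0n big_nat_recr//=.
    rewrite -[leLHS]adde0; apply: leeD; last exact: nneseries_ge0.
    rewrite -[leLHS]add0e; apply: leeD; first exact: sume_ge0.
    by rewrite /v indicE mem_set// mulr1.
Qed.

Lemma is_derive_locally_lipschitz (R : realType) (F : R -> R) (z df k : R) :
  is_derive z 1 F df -> `|df| < k ->
  \forall y \near z, `|F y - F z| <= k * `|y - z|.
Proof.
move=> [dF dFE] dfk.
have cF : h^-1 *: (F (h *: 1 + z) - F z) @[h --> 0^'] --> df.
  by rewrite -dFE; exact: dF.
have /cvgr_norm_lt : `|df| < k by [].
move=> /(_ _ _ _ _ cF) /=.
rewrite near_withinE => -[e /= e0 He].
exists e => //= y /= zy.
have [->|yz] := eqVneq y z; first by rewrite !subrr normr0 mulr0.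
have zy' : `|y - z| < e by rewrite distrC.
have := He (y - z); rewrite /ball_/= sub0r normrN subr_eq0 => /(_ zy' yz).
rewrite /= scaler1 subrK /GRing.scale/= normrM normfV ltr_pdivrMl; last first.
  by rewrite normr_gt0 subr_eq0.
by move=> /ltW; rewrite mulrC.
Qed.

(** Around [z] the majorant [u] is at least some [k] above [|f z|], and increments of [F] from [z]
    have slope at most [k]. On a short interval [x, y] containing [z] this gives an increment of at
    most [k * (y - x)], itself at most the integral of [u]. Both sides behave well under
    concatenation, so the bound extends to [a, b]; then [e] tends to 0. *)
Lemma increment_le_integral_norm_derive (R : realType) (F f : R -> R) (a b : R) :
  a <= b -> (forall z, a <= z <= b -> is_derive z 1 F (f z)) ->
  measurable_fun `[a, b] f ->
  (`|F b - F a|%:E <= \int[lebesgue_measure]_(x in `[a, b]) `|f x|%:E)%E.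
Proof.
move=> ab dF mf; apply/lee_addgt0Pr => e e0.
have mI : measurable (`[a, b]%classic : set R) by exact: measurable_itv.
have muI : (@lebesgue_measure R `[a, b] < +oo)%E.
  by rewrite lebesgue_measure_itv/=; case: ifP => _; rewrite ltry.
have mnf : measurable_fun `[a, b] (fun x => `|f x|) by exact: measurableT_comp.
have [u [mu0 u0 le_u locu]] :=
  vitali_caratheodory mI muI mnf (fun x _ => normr_ge0 _) e0.
apply: le_trans le_u.
pose P x y := (`|F y - F x|%:E <= \int[lebesgue_measure]_(t in `[x, y]) u t)%E.
apply: (@segment_additive_ind R a b P ab).
- move=> x y z ax xy yz zb Pxy Pyz; rewrite /P.
  have -> : `[x, z]%classic = `[x, y] `|` `]y, z].
    by rewrite -itv_bndbnd_setU// bnd_simp.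
  rewrite ge0_integral_setU//; last 2 first.
  + exact: measurable_funTS.
  + apply/disj_setPS => t [/=]; rewrite !in_itv/= => /andP[_ ty] /andP[].
    by rewrite ltNge ty.
  rewrite integral_itv_obnd_cbnd; last exact: measurable_funTS.
  apply: le_trans (leeD Pxy Pyz).
  rewrite -EFinD lee_fin.
  have -> : F z - F x = (F y - F x) + (F z - F y) by ring.
  exact: ler_normD.
- move=> z azb; have /locu [U [k [oU Uz fzk Uk]]] : `[a, b]%classic z.
    by rewrite /= in_itv.
  have [e1 /= e10 He1] := is_derive_locally_lipschitz (dF z azb) fzk.
  have [e2 /= e20 He2] : nbhs z U by exact: open_nbhs_nbhs.
  exists (Num.min e1 e2); first by rewrite lt_min e10.
  move=> x y ax xz zy yb xe ye.
  have k0 : 0 <= k by apply: le_trans (ltW fzk).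
  have ballxy t : x <= t -> t <= y -> `|z - t| < Num.min e1 e2.
    by move=> xt ty; rewrite ltr_norml; apply/andP; split; lra.
  have incr t : x <= t -> t <= y -> `|F t - F z| <= k * `|t - z|.
    move=> xt ty; apply: He1 => /=; rewrite /ball_/=.
    by have := ballxy t xt ty; rewrite lt_min => /andP[].
  have Uxy t : x <= t -> t <= y -> (k%:E <= u t)%E.
    move=> xt ty; apply/Uk/He2; rewrite /ball_/=.
    by have := ballxy t xt ty; rewrite lt_min => /andP[].
  have xy := le_trans xz zy.
  rewrite /P; apply: (@le_trans _ _ (k * (y - x))%:E).
    rewrite lee_fin.
    have := incr x (lexx x) xy; have := incr y xy (lexx y).
    rewrite (ger0_norm (_ : 0 <= y - z)) ?subr_ge0//.
    rewrite (ler0_norm (_ : x - z <= 0)) ?subr_le0//.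
    rewrite !ler_norml => /andP[? ?] /andP[? ?]; apply/andP; split; nra.
  have -> : (k * (y - x))%:E = (\int[lebesgue_measure]_(t in `[x, y]) k%:E)%E.
    rewrite integral_cst//= lebesgue_measure_itv/= lte_fin.
    have [_|yx] := ltP x y; first by rewrite -EFinB -EFinM.
    have -> : y = x by apply/eqP; rewrite eq_le yx xy.
    by rewrite subrr mulr0 mule0.
  apply: ge0_le_integral => //.
  + exact: measurable_funTS.
  + by move=> t; rewrite /= in_itv/= => /andP[? ?]; exact: Uxy.
Qed.

(** The previous bound holds on every [x, y] strictly inside, with a right-hand side that does not
    depend on [x] and [y]. Letting [y] tend to [b] and then [x] to [a] leaves only continuity to be
    asked of [F] at the ends. *)
Lemma increment_le_Rintegral_norm_derive (R : realType) (F f : R -> R) (a b : R) :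
  a < b -> (forall z, a < z < b -> is_derive z 1 F (f z)) ->
  F x @[x --> a^'+] --> F a -> F x @[x --> b^'-] --> F b ->
  (@lebesgue_measure R).-integrable `[a, b] (EFin \o f) ->
  `|F b - F a| <= \int[lebesgue_measure]_(x in `[a, b]) `|f x|.
Proof.
move=> ab dF Fa Fb intf.
have inner x y : a < x -> x <= y -> y < b ->
    `|F y - F x| <= \int[lebesgue_measure]_(x in `[a, b]) `|f x|.
  move=> ax xy yb.
  have sub : `[x, y]%classic `<=` `[a, b]%classic.
    by move=> t; rewrite /= !in_itv/= => /andP[? ?]; apply/andP; split; lra.
  have mf : measurable_fun `[a, b] f.
    by apply/measurable_EFinP; exact: measurable_int intf.
  rewrite -lee_fin.
  have inc : (`|F y - F x|%:E <= \int[lebesgue_measure]_(t in `[x, y]) `|f t|%:E)%E.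
    apply: increment_le_integral_norm_derive => //.
      by move=> z /andP[? ?]; apply: dF; apply/andP; split; lra.
    exact: measurable_funS mf.
  apply: (le_trans inc).
  have intnf := integrable_norm intf.
  rewrite /Rintegral fineK; last exact: integrable_fin_num intnf.
  apply: ge0_subset_integral => //.
  by apply/measurable_EFinP; exact: measurableT_comp.
have right x : a < x -> x < b ->
    `|F b - F x| <= \int[lebesgue_measure]_(x in `[a, b]) `|f x|.
  move=> ax xb.
  have cvb : `|F y - F x| @[y --> b^'-] --> `|F b - F x|.
    by apply: cvg_norm; apply: cvgB => //; exact: cvg_cst.
  rewrite -(cvg_lim _ cvb)//; apply: limr_le; first exact: cvgP cvb.
  apply: filterS2 (nbhs_left_ge xb) (nbhs_left_lt b) => y xy yb.
  exact: inner.
have cva : `|F b - F x| @[x --> a^'+] --> `|F b - F a|.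
  by apply: cvg_norm; apply: cvgB => //; exact: cvg_cst.
rewrite -(cvg_lim _ cva)//; apply: limr_le; first exact: cvgP cva.
apply: filterS2 (nbhs_right_gt a) (nbhs_right_lt ab) => x ax xb.
exact: right.
Qed.

(* If [g] is continuous and [G] is a primitive of [g], then [F - G] has
   derivative [f - g] at every point of ]a, b[, so both [F b - F a] and the
   integral of [f] differ from [G b - G a] by at most the L1 norm of
   [f - g]. *)
Lemma integrable_derive_FTC (R : realType) (F f : R -> R) (a b : R) :
  a < b -> (forall z, a < z < b -> is_derive z 1 F (f z)) ->
  F x @[x --> a^'+] --> F a -> F x @[x --> b^'-] --> F b ->
  (@lebesgue_measure R).-integrable `[a, b] (EFin \o f) ->
  \int[lebesgue_measure]_(x in `[a, b]) f x = F b - F a.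
Proof.
move=> ab dF Fa Fb intf.
have mI : measurable (`[a, b]%classic : set R) by exact: measurable_itv.
have muI : (@lebesgue_measure R `[a, b] < +oo)%E.
  by rewrite lebesgue_measure_itv/=; case: ifP => _; rewrite ltry.
have [g [cg intg g_f]] := approximation_continuous_integrable mI muI intf.
have intfg n : (@lebesgue_measure R).-integrable `[a, b] (EFin \o (f \- g n)).
  by rewrite (_ : EFin \o _ = (EFin \o f) \- (EFin \o g n))%E//; exact: integrableB.
set I := \int[lebesgue_measure]_(x in `[a, b]) f x.
have bound n : `|F b - F a - I| <=
    2 * \int[lebesgue_measure]_(x in `[a, b]) `|f x - g n x|.
  pose G x := \int[lebesgue_measure]_(t in `[a, x]) g n t.
  have intg1 : (@lebesgue_measure R).-integrable `[a, b + 1] (EFin \o g n).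
    apply: continuous_compact_integrable; first exact: segment_compact.
    exact: continuous_subspaceT.
  have dG z : a < z < b -> is_derive z 1 G (g n z).
    move=> /andP[az zb].
    have zb1 : z < b + 1 by rewrite (lt_trans zb)// ltrDl.
    have [d1 d2] := continuous_FTC1_closed zb1 intg1 az (cg n z).
    by split => //; rewrite -derive1E.
  have [_ Ga Gb] := (continuous_within_itvP _ ab).1
    (parameterized_integral_continuous (ltW ab) (intg n)).
  have inc := @increment_le_Rintegral_norm_derive R (F \- G) (f \- g n) a b ab.
  have {}inc : `|F b - G b - (F a - G a)| <=
      \int[lebesgue_measure]_(x in `[a, b]) `|f x - g n x|.
    apply: inc => //; [|exact: cvgB..].
    by move=> z azb; apply: is_deriveB; [exact: dF|exact: dG].
  have Ga0 : G a = 0 by rewrite /G set_itv1 Rintegral_set1.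
  have {}inc : `|F b - F a - G b| <=
      \int[lebesgue_measure]_(x in `[a, b]) `|f x - g n x|.
    by apply: le_trans inc; rewrite Ga0 subr0 addrAC.
  have : `|I - G b| <= \int[lebesgue_measure]_(x in `[a, b]) `|f x - g n x|.
    rewrite /I /G -RintegralB//.
    apply: le_normr_Rintegral => //; exact: intfg.
  rewrite distrC => IG; rewrite mulr2n mulrDl mul1r.
  rewrite (_ : F b - F a - I = (F b - F a - G b) + (G b - I)); last by ring.
  by apply: le_trans (ler_normD _ _) _; exact: lerD.
apply/esym/eqP; rewrite -subr_eq0 -normr_le0; apply/ler_addgt0Pl => e e0.
rewrite addr0.
have e20 : 0 < e / 2 by rewrite divr_gt0.
have [n _ /(_ n (leqnn n)) /= en] := cvgr_lt 0 (fine_cvg g_f) _ e20.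
apply: (le_trans (bound n)); rewrite mulrC -ler_pdivlMr//.
exact: ltW.
Qed.

Lemma is_derive_cvg (R : realType) (F : R -> R) (x df : R) :
  is_derive x 1 F df -> F t @[t --> x] --> F x.
Proof. by move=> [dF _]; apply/differentiable_continuous/derivable1_diffP. Qed.

(** * The Gamma function *)

(** The fundamental theorem has integrability among its hypotheses, so it cannot be applied on
    [0, x] when the power is singular at 0. On [y, x] with [y > 0] it bounds the integral by
    [x^s / s] uniformly in [y], and monotone convergence along [y = x / n.+1] gives finiteness on
    ]0, x]. *)
Lemma integrable_powRB1 (R : realType) (s x : R) : 0 < s -> 0 < x ->
  (@lebesgue_measure R).-integrable `[0, x] (fun t => (t `^ (s - 1))%:E).
Proof.
move=> s0 x0.
have dpow (t : R) : 0 < t ->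
    is_derive t 1 (fun t : R => s^-1 * t `^ s) (t `^ (s - 1)).
  move=> t0; have dt := is_derive1_powR s t0.
  have -> : t `^ (s - 1) = s^-1 *: (s * t `^ (s - 1)).
    by rewrite /GRing.scale/= mulKf ?gt_eqF.
  exact: is_deriveZ.
have piece y : 0 < y -> y <= x ->
    (\int[lebesgue_measure]_(t in `[y, x]) (t `^ (s - 1))%:E <=
     (s^-1 * x `^ s)%:E)%E.
  move=> y0; rewrite le_eqVlt => /predU1P[->|yx].
    by rewrite set_itv1 integral_set1 lee_fin mulr_ge0 ?powR_ge0// invr_ge0 ltW.
  have intp : (@lebesgue_measure R).-integrable `[y, x]
      (EFin \o (fun t => t `^ (s - 1))).
    apply: continuous_compact_integrable; first exact: segment_compact.
    apply: derivable_within_continuous => t; rewrite in_itv/= => /andP[yt _].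
    by have [] := is_derive1_powR (s - 1) (lt_le_trans y0 yt).
  have FTC : \int[lebesgue_measure]_(t in `[y, x]) (t `^ (s - 1)) =
      s^-1 * x `^ s - s^-1 * y `^ s.
    apply: (@integrable_derive_FTC R (fun t => s^-1 * t `^ s)) => //.
    - by move=> z /andP[yz _]; apply: dpow; exact: lt_trans yz.
    - exact/cvg_at_right_filter/(is_derive_cvg (dpow _ y0)).
    - exact/cvg_at_left_filter/(is_derive_cvg (dpow _ x0)).
  rewrite -(fineK (integrable_fin_num _ intp))//= lee_fin.
  rewrite [leLHS]FTC.
  by rewrite lerBlDr lerDl mulr_ge0 ?powR_ge0// invr_ge0 ltW.
have mpow : measurable_fun [set: R] (fun t : R => (t `^ (s - 1))%:E).
  by apply/measurable_EFinP; exact: measurable_powR.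
apply/integrableP; split; first exact: measurable_funTS.
under eq_integral do rewrite gee0_abs ?lee_fin ?powR_ge0//.
rewrite -integral_itv_obnd_cbnd; last exact: measurable_funTS.
apply: (@le_lt_trans _ _ (s^-1 * x `^ s)%:E); last exact: ltry.
pose F n := `[n.+1%:R^-1 * x, x]%classic.
have -> : `]0, x]%classic = \bigcup_n F n.
  apply/seteqP; split=> [t|t [n _]]; rewrite /F /= !in_itv/= => /andP[t0 tx].
    have xt : 0 <= x / t by rewrite divr_ge0// ltW.
    exists (Num.truncn (x / t)) => //=; rewrite in_itv/= tx andbT.
    have /andP[_ /ltW] := truncn_itv xt.
    by rewrite ler_pdivrMr// ler_pdivrMl.
  by rewrite tx andbT (lt_le_trans _ t0)// mulr_gt0.
have ndF : nondecreasing_seq F.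
  move=> m n mn; rewrite subsetEset => t; rewrite /F /= !in_itv/= => /andP[mt ->].
  rewrite andbT; apply: le_trans mt; rewrite ler_wpM2r ?(ltW x0)//.
  by rewrite lef_pV2 ?posrE// ler_nat.
have mF n : measurable (F n) by exact: measurable_itv.
have cF : (\int[lebesgue_measure]_(t in F n) (t `^ (s - 1))%:E @[n --> \oo] -->
    \int[lebesgue_measure]_(t in \bigcup_n F n) (t `^ (s - 1))%:E)%E.
  apply: ge0_nondecreasing_set_cvg_integral => //.
  - by move=> n; exact: measurable_funTS.
  - by move=> n t _; rewrite lee_fin powR_ge0.
rewrite -(cvg_lim _ cF)//; apply: lime_le; first exact: cvgP cF.
apply: nearW => n; apply: piece; first by rewrite mulr_gt0.
by rewrite ler_piMl ?(ltW x0)// invf_le1 // ler1n.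
Qed.

(** This is [u <= expR u] at [u = t / (2 * s)], raised to the power [s]. The factor 2 makes the
    exponential grow only like [expR (t / 2)], so that multiplying by [expR (- t)] still leaves
    exponential decay. *)
Lemma powR_le_expR (R : realType) (s t : R) : 0 < s -> 0 <= t ->
  t `^ s <= (2 * s) `^ s * expR (t / 2).
Proof.
move=> s0 t0.
have s20 : 0 < 2 * s by rewrite mulr_gt0.
have tE : t = 2 * s * (t / (2 * s)) by rewrite mulrCA divff ?gt_eqF// mulr1.
have ts0 : 0 <= t / (2 * s) by rewrite divr_ge0// ltW.
rewrite {1}tE powRM ?(ltW s20)// ler_wpM2l ?powR_ge0//.
have le_exp : t / (2 * s) <= expR (t / (2 * s)).
  by apply: le_trans (expR_ge1Dx _); rewrite lerDr.
apply: (@le_trans _ _ (expR (t / (2 * s)) `^ s)).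
  by apply: ge0_ler_powR; rewrite ?nnegrE ?expR_ge0// ltW.
by rewrite -expRM ler_expR invfM mulrA mulfVK ?gt_eqF.
Qed.

Definition gamma_integrand (R : realType) (s t : R) : R :=
  t `^ (s - 1) * expR (- t).

Lemma gamma_integrand_ge0 (R : realType) (s t : R) : 0 <= gamma_integrand s t.
Proof. by rewrite mulr_ge0 ?powR_ge0 ?expR_ge0. Qed.

Lemma measurable_gamma_integrand (R : realType) (s : R) (D : set R) :
  measurable_fun D (fun t => (gamma_integrand s t)%:E).
Proof.
apply/measurable_EFinP/measurable_funTS/measurable_funM.
  exact: measurable_powR.
exact: measurableT_comp.
Qed.

Lemma integrable_gamma_integrand (R : realType) (s x : R) : 0 < s -> 0 < x ->
  (@lebesgue_measure R).-integrable `[0, x] (EFin \o gamma_integrand s).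
Proof.
move=> s0 x0; apply: le_integrable (integrable_powRB1 s0 x0) => //.
  exact: measurable_gamma_integrand.
move=> t; rewrite /= in_itv/= => /andP[t0 _].
rewrite lee_fin ger0_norm ?gamma_integrand_ge0// ger0_norm ?powR_ge0//.
by rewrite ler_piMr ?powR_ge0// -expR0 ler_expR oppr_le0.
Qed.

(** The primitive is [t^s * expR (- t)], which vanishes at 0 since [s > 0]. This truncated identity
    serves three times: for the finiteness of [Gamma], for its functional equation and for its
    positivity. *)
Lemma gamma_integrand_by_parts (R : realType) (s x : R) : 0 < s -> 0 < x ->
  s * \int[lebesgue_measure]_(t in `[0, x]) gamma_integrand s t =
  x `^ s * expR (- x) +
  \int[lebesgue_measure]_(t in `[0, x]) gamma_integrand (s + 1) t.
Proof.
move=> s0 x0.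
have int0 := integrable_gamma_integrand s0 x0.
have int1 := integrable_gamma_integrand (addr_gt0 s0 ltr01) x0.
have intZ : (@lebesgue_measure R).-integrable `[0, x]
    (EFin \o (fun t => s * gamma_integrand s t)).
  rewrite (_ : EFin \o _ = (fun t => s%:E * (gamma_integrand s t)%:E)%E) //.
  exact: integrableZl.
rewrite -RintegralZl//; apply/eqP; rewrite -subr_eq -RintegralB//; apply/eqP.
pose F (t : R) := t `^ s * expR (- t).
have dF (t : R) : 0 < t ->
    is_derive t 1 F (s * gamma_integrand s t - gamma_integrand (s + 1) t).
  move=> t0; have d1 := is_derive1_powR s t0.
  have d2 : is_derive t 1 (fun t : R => expR (- t)) (expR (- t) * -1).
    by apply: is_derive1_comp.
  apply: is_derive_eq (is_deriveM d1 d2) _.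
  by rewrite /gamma_integrand /GRing.scale/= addrK; ring.
have F0 : F 0 = 0 by rewrite /F powR0 ?mul0r// gt_eqF.
have -> : x `^ s * expR (- x) = F x - F 0 by rewrite F0 subr0.
apply: integrable_derive_FTC => //.
- by move=> z /andP[z0 _]; exact: dF.
- rewrite F0 -[X in _ --> X](mul0r (expR (- 0))).
  apply: cvgM; first exact: powR_cvg0.
  apply: cvg_at_right_filter; apply: continuous_comp => //.
    exact: continuousN.
  exact: continuous_expR.
- exact/cvg_at_left_filter/(is_derive_cvg (dF _ x0)).
- rewrite (_ : EFin \o _ = (EFin \o (fun t => s * gamma_integrand s t)%R) \-
    (EFin \o gamma_integrand (s + 1)%R))%E//; exact: integrableB.
Qed.

Lemma cvg_gamma_integrand (R : realType) (s : R) :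
  (\int[lebesgue_measure]_(t in `[0%R, n%:R%R]) (gamma_integrand s t)%:E
    @[n --> \oo] -->
   \int[lebesgue_measure]_(t in `[0%R, +oo[) (gamma_integrand s t)%:E)%E.
Proof.
rewrite (itv_bndy_bigcup_BRight true 0).
under [X in _ --> (\int[_]_(_ in X) _)%E]eq_bigcupr do rewrite add0r.
apply: ge0_nondecreasing_set_cvg_integral => //.
- move=> m n mn; rewrite subsetEset => t; rewrite /= !in_itv/= => /andP[-> tm].
  by rewrite (le_trans tm)// ler_nat.
- by move=> n; exact: measurable_gamma_integrand.
- by move=> n t _; rewrite lee_fin gamma_integrand_ge0.
Qed.

(** With parameter [s + 1] the power is [t^s], to which [powR_le_expR] applies. The integrand is
    thus below [C * expR (- t / 2)], whose integral stays below [2 * C] however large [x] is. *)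
Lemma gamma_integrand_tail (R : realType) (s x : R) : 0 < s -> 0 < x ->
  \int[lebesgue_measure]_(t in `[0, x]) gamma_integrand (s + 1) t <=
  2 * (2 * s) `^ s.
Proof.
move=> s0 x0; set C := (2 * s) `^ s.
have C0 : 0 <= C by exact: powR_ge0.
pose F (t : R) := - 2 * C * expR (- t / 2).
have dF (t : R) : is_derive t 1 F (C * expR (- t / 2)).
  have d1 : is_derive t 1 (fun t : R => - t / 2) (- 2^-1).
    rewrite (_ : (fun t : R => - t / 2) = (fun t => - 2^-1 *: t)); last first.
      by apply/funext => y; rewrite /GRing.scale/= mulNr mulrC mulNr.
    apply: is_derive_eq (is_deriveZ _ (is_derive_id t (1 : R))) _.
    by rewrite /GRing.scale/= mulr1.
  have d2 : is_derive t 1 (expR \o (fun y : R => - y / 2))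
      (expR (- t / 2) * - 2^-1) by apply: is_derive1_comp.
  apply: is_derive_eq (is_deriveZ (- 2 * C) d2) _.
  by rewrite /GRing.scale/=; field.
have intb : (@lebesgue_measure R).-integrable `[0, x]
    (EFin \o (fun t => C * expR (- t / 2))).
  apply: continuous_compact_integrable; first exact: segment_compact.
  apply: continuous_subspaceT => t; apply: cvgM; first exact: cvg_cst.
  apply: continuous_comp; last exact: continuous_expR.
  by apply: cvgM; [exact: continuousN|exact: cvg_cst].
have FTC : \int[lebesgue_measure]_(t in `[0, x]) (C * expR (- t / 2)) = F x - F 0.
  apply: integrable_derive_FTC => //.
  - exact/cvg_at_right_filter/(is_derive_cvg (dF _)).
  - exact/cvg_at_left_filter/(is_derive_cvg (dF _)).
apply: (@le_trans _ _ (F x - F 0)).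
  rewrite -FTC; apply: le_Rintegral => //.
    by apply: integrable_gamma_integrand => //; rewrite addr_gt0.
  move=> t; rewrite /= in_itv/= => /andP[t0 _].
  rewrite /gamma_integrand addrK.
  have -> : C * expR (- t / 2) = C * expR (t / 2) * expR (- t).
    rewrite -mulrA -expRD; congr (_ * expR _); lra.
  by rewrite ler_wpM2r ?expR_ge0// powR_le_expR.
rewrite /F oppr0 mul0r expR0.
have := expR_ge0 (- x / 2); nra.
Qed.

(** A real-valued integral is the [fine] part of an extended one and would be 0 if the latter were
    infinite. A bound uniform in [n] on the truncated integrals rules this out. *)
Lemma cvg_Rintegral_gamma_integrand (R : realType) (s : R) : 0 < s ->
  \int[lebesgue_measure]_(t in `[0, n%:R]) gamma_integrand s t
    @[n --> \oo] --> Gamma s.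
Proof.
move=> s0.
have GammaE : Gamma s =
    fine (\int[lebesgue_measure]_(t in `[0%R, +oo[) (gamma_integrand s t)%:E)%E.
  rewrite -integral_itv_obnd_cbnd//; exact: measurable_gamma_integrand.
have tail n : \int[lebesgue_measure]_(t in `[0, n%:R]) gamma_integrand s t <=
    s^-1 * ((2 * s) `^ s + 2 * (2 * s) `^ s).
  (* Integration by parts trades the power [s - 1], possibly negative, for the power [s], where the
     exponential bound is available. It needs a positive right end, so the degenerate segment is
     treated apart. *)
  case: n => [|n].
    rewrite set_itv1 Rintegral_set1 mulr_ge0 ?invr_ge0 ?(ltW s0)//.
    by rewrite addr_ge0 ?mulr_ge0 ?powR_ge0.
  rewrite ler_pdivlMl// gamma_integrand_by_parts// lerD//; last first.
    exact: gamma_integrand_tail.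
  have := powR_le_expR s0 (ler0n R n.+1).
  move=> /(ler_wpM2r (expR_ge0 (- n.+1%:R)))/le_trans; apply.
  rewrite -mulrA -expRD ler_piMr ?powR_ge0//.
  rewrite -[leRHS]expR0 ler_expR.
  have := ler0n R n.+1; lra.
have fin n : (\int[lebesgue_measure]_(t in `[0%R, n%:R%R])
    (gamma_integrand s t)%:E)%E \is a fin_num.
  case: n => [|n]; first by rewrite set_itv1 integral_set1.
  by apply: integrable_fin_num => //; exact: integrable_gamma_integrand.
have cG := @cvg_gamma_integrand R s.
rewrite GammaE; apply: fine_cvg; rewrite fineK//.
rewrite ge0_fin_numE; last first.
  by apply: integral_ge0 => t _; rewrite lee_fin gamma_integrand_ge0.
rewrite -(cvg_lim _ cG)//.
apply: le_lt_trans (ltry (s^-1 * ((2 * s) `^ s + 2 * (2 * s) `^ s))).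
apply: lime_le; first exact: cvgP cG.
by apply: nearW => n; rewrite -(fineK (fin n)) lee_fin; exact: tail.
Qed.

(** Both sides of the integration by parts over [0, n] have limits, and the boundary term
    [n^s * expR (- n)] is squeezed to 0 by a multiple of [expR (- n / 2)]. *)
Lemma GammaS (R : realType) (s : R) : 0 < s -> Gamma (s + 1) = s * Gamma s.
Proof.
move=> s0.
have cb : n%:R `^ s * expR (- n%:R) @[n --> \oo] --> (0 : R).
  have ce : (2 * s) `^ s * expR (- (n%:R / 2)) @[n --> \oo] --> (0 : R).
    rewrite -[X in _ --> X](mulr0 ((2 * s) `^ s)).
    apply: cvgM; first exact: cvg_cst.
    apply: (@cvg_comp _ _ _ (fun n : nat => n%:R : R) (fun x => expR (- (x / 2)))).
      exact: cvgr_idn.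
    apply: (@cvg_comp _ _ _ (fun x : R => x / 2) (fun x => expR (- x))).
      by apply: gt0_cvgMly; [rewrite invr_gt0|exact: cvg_id].
    exact: cvgr_expR.
  apply: squeeze_cvgr (cvg_cst 0) ce.
  apply: nearW => n; rewrite mulr_ge0 ?powR_ge0 ?expR_ge0//=.
  have := powR_le_expR s0 (ler0n R n).
  move=> /(ler_wpM2r (expR_ge0 (- n%:R)))/le_trans; apply.
  rewrite -mulrA -expRD ler_wpM2l ?powR_ge0// ler_expR; lra.
have cS := cvg_Rintegral_gamma_integrand (addr_gt0 s0 ltr01).
have cs : s * \int[lebesgue_measure]_(t in `[0, n%:R]) gamma_integrand s t
    @[n --> \oo] --> s * Gamma s.
  by apply: cvgM; [exact: cvg_cst|exact: cvg_Rintegral_gamma_integrand].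
have cs' : s * \int[lebesgue_measure]_(t in `[0, n%:R]) gamma_integrand s t
    @[n --> \oo] --> 0 + Gamma (s + 1).
  apply: cvg_trans (cvgD cb cS); apply: near_eq_cvg.
  by exists 1%N => // n /= n1; rewrite gamma_integrand_by_parts// ltr0n.
by rewrite (cvg_unique _ cs cs')// add0r.
Qed.

(** Integration by parts over [0, 1] already gives positivity: the boundary term at 1 is positive
    and the remaining integral is nonnegative. *)
Lemma Gamma_gt0 (R : realType) (s : R) : 0 < s -> 0 < Gamma s.
Proof.
move=> s0.
have I1 : 0 < \int[lebesgue_measure]_(t in `[0, 1]) gamma_integrand s t.
  rewrite -(pmulr_rgt0 _ s0) gamma_integrand_by_parts//.
  rewrite ltr_pwDl// ?mulr_gt0 ?powR_gt0 ?expR_gt0//.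
  by apply: Rintegral_ge0 => t _; exact: gamma_integrand_ge0.
apply: (lt_le_trans I1).
have cG := cvg_Rintegral_gamma_integrand s0.
rewrite -(cvg_lim _ cG)//; apply: limr_ge; first exact: cvgP cG.
exists 1%N => // n /= n1.
have int_n : (@lebesgue_measure R).-integrable `[0, n%:R]
    (EFin \o gamma_integrand s).
  by apply: integrable_gamma_integrand; rewrite ?ltr0n.
have int_1 : (@lebesgue_measure R).-integrable `[0, 1]
    (EFin \o gamma_integrand s) by exact: integrable_gamma_integrand.
rewrite -lee_fin /Rintegral !fineK; [|exact: integrable_fin_num..].
apply: ge0_subset_integral => //; first exact: measurable_gamma_integrand.
- by move=> t _; rewrite lee_fin gamma_integrand_ge0.
- move=> t; rewrite /= !in_itv/= => /andP[-> t1].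
  by rewrite (le_trans t1)// ler1n.
Qed.

(** * Affine substitution and weighted Hoelder inequality *)

(** Lebesgue measure is determined by its values on half-open intervals, where the rescaled
    pushforward is computed directly. Negative [k] is included for the sake of reflections; it moves
    the closed end of the interval to the other side, which leaves the length unchanged. *)
Lemma lebesgue_measure_affine (R : realType) (k r : R) (A : set R) :
  k != 0 -> measurable A ->
  (@lebesgue_measure R A =
   `|k|%:E * @lebesgue_measure R ((fun x => r + k * x)%R @^-1` A))%E.
Proof.
move=> k0 mA.
pose phi : measurableTypeR R -> measurableTypeR R := fun x => r + k * x.
have mphi : measurable_fun setT phi.
  by apply: measurable_funD => //; exact: measurable_funM.
have nk0 : 0 <= `|k| by [].
pose nu : {measure set (measurableTypeR R) -> \bar R} :=
  mscale (NngNum nk0)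
    (measure_function_pushforward__canonical__measure_function_Measure
      (@lebesgue_measure R) mphi).
rewrite (@lebesgue_measure_unique R nu)// => _ [[x y] _ <-].
rewrite /nu /= /mscale /= /pushforward.
have [kn|kp|/eqP] := ltgtP k 0; last by rewrite (negbTE k0).
- have -> : phi @^-1` `]x, y] = `[(y - r) / k, (x - r) / k[%classic.
    apply/seteqP; split => z; rewrite /phi /= !in_itv/=.
      rewrite ler_ndivrMr// ltr_ndivlMr// => /andP[? ?].
      by apply/andP; split; nra.
    by rewrite ler_ndivrMr// ltr_ndivlMr// => /andP[? ?]; apply/andP; split; nra.
  rewrite !lebesgue_measure_itv/= !lte_fin ltr_ndivrMr// divfK// ltrD2r.
  case: ifP => _; last by rewrite mule0.
  by rewrite -!EFinB -EFinM ltr0_norm//; congr (_%:E); field.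
- have -> : phi @^-1` `]x, y] = `](x - r) / k, (y - r) / k]%classic.
    apply/seteqP; split => z; rewrite /phi /= !in_itv/=.
      rewrite ltr_pdivrMr// ler_pdivlMr// => /andP[? ?].
      by apply/andP; split; nra.
    by rewrite ltr_pdivrMr// ler_pdivlMr// => /andP[? ?]; apply/andP; split; nra.
  rewrite !lebesgue_measure_itv/= !lte_fin ltr_pdivrMr// divfK// ltrD2r.
  case: ifP => _; last by rewrite mule0.
  by rewrite -!EFinB -EFinM gtr0_norm//; congr (_%:E); field.
Qed.

Lemma ge0_integral_affine (R : realType) (k r : R) (D : set R)
    (f : R -> \bar R) :
  k != 0 -> measurable D -> measurable_fun D f ->
  (forall x, D x -> (0 <= f x)%E) ->
  (\int[lebesgue_measure]_(x in D) f x =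
   `|k|%:E * \int[lebesgue_measure]_(x in (fun x => r + k * x)%R @^-1` D)
     f (r + k * x)%R)%E.
Proof.
move=> k0 mD mf f0.
pose phi : measurableTypeR R -> measurableTypeR R := fun x => r + k * x.
have mphi : measurable_fun setT phi.
  by apply: measurable_funD => //; exact: measurable_funM.
have nk0 : 0 <= `|k| by [].
pose nu : {measure set (measurableTypeR R) -> \bar R} :=
  measure_function_pushforward__canonical__measure_function_Measure
    (@lebesgue_measure R) mphi.
rewrite -(@ge0_integral_pushforward _ _ _ _ R phi mphi lebesgue_measure D f)//.
  rewrite -(@ge0_integral_mscale _ _ _ nu D mD (NngNum nk0) f)//.
  apply: eq_measure_integral => A mA _.
  exact: (lebesgue_measure_affine r k0 mA).
by move=> y; rewrite inE; exact: f0.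
Qed.

(** Ordinary Hoelder for [w^(1/p)] and [w^(1/q) * g], whose product is [w * g] because the exponents
    add up to 1. Both are extended by 0 outside [D] to pass to integrals over the whole space. *)
Lemma weighted_hoelder d (T : measurableType d) (R : realType)
    (mu : {measure set T -> \bar R}) (D : set T) (w g : T -> R) (p q : R) :
  measurable D -> measurable_fun D w -> measurable_fun D g ->
  (forall x, D x -> 0 <= w x) -> (forall x, D x -> 0 <= g x) ->
  0 < p -> 0 < q -> p^-1 + q^-1 = 1 ->
  (\int[mu]_(x in D) (w x * g x)%:E <=
   (\int[mu]_(x in D) (w x)%:E) `^ p^-1 *
   (\int[mu]_(x in D) (w x * g x `^ q)%R%:E) `^ q^-1)%E.
Proof.
move=> mD mw mg w0 g0 p0 q0 pq.
pose F : T -> R := (fun x => w x `^ p^-1) \_ D.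
pose G : T -> R := (fun x => w x `^ q^-1 * g x) \_ D.
have mF : measurable_fun [set: T] F.
  apply/(measurable_restrictT _ mD).
  by apply: (measurableT_comp (measurable_powR _)).
have mG : measurable_fun [set: T] G.
  apply/(measurable_restrictT _ mD); apply: measurable_funM => //.
  by apply: (measurableT_comp (measurable_powR _)).
have := hoelder mu mF mG p0 q0 pq.
rewrite Lnorm1 unlock /=.
have -> : (\int[mu]_x `|((F x * G x)%R)%:E| = \int[mu]_(x in D) (w x * g x)%:E)%E.
  rewrite [RHS]integral_mkcond; apply: eq_integral => x _.
  rewrite /F /G !patchE; case: ifPn => [|_]; last by rewrite mul0r abse0.
  rewrite inE => Dx; rewrite mulrA -powRD; last by rewrite pq oner_eq0.
  by rewrite pq powRr1 ?w0//= ger0_norm// mulr_ge0 ?w0 ?g0.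
have -> : (\int[mu]_x (`|(F x)%:E| `^ p) = \int[mu]_(x in D) (w x)%:E)%E.
  rewrite [RHS]integral_mkcond; apply: eq_integral => x _.
  rewrite /F !patchE; case: ifPn => [|_]; last first.
    by rewrite /= normr0 powR0// gt_eqF.
  rewrite inE => Dx.
  by rewrite /= ger0_norm ?powR_ge0// -powRrM mulVf ?gt_eqF// powRr1 ?w0.
have -> : (\int[mu]_x (`|(G x)%:E| `^ q) =
           \int[mu]_(x in D) (w x * g x `^ q)%R%:E)%E.
  rewrite [RHS]integral_mkcond; apply: eq_integral => x _.
  rewrite /G !patchE; case: ifPn => [|_]; last first.
    by rewrite /= normr0 powR0// gt_eqF.
  rewrite inE => Dx.
  rewrite /= ger0_norm; last by rewrite mulr_ge0 ?powR_ge0 ?g0.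
  rewrite powRM ?powR_ge0 ?g0// -powRrM mulVf ?gt_eqF// powRr1 ?w0//.
by [].
Qed.

Lemma integrable_affine (R : realType) (k r : R) (D : set R) (f : R -> R) :
  k != 0 -> measurable D -> measurable_fun [set: R] f ->
  (@lebesgue_measure R).-integrable D (EFin \o f) ->
  (@lebesgue_measure R).-integrable ((fun x => r + k * x) @^-1` D)
    (EFin \o (fun x => f (r + k * x))).
Proof.
move=> k0 mD mf intf.
have mphi : measurable_fun [set: R] (fun x => r + k * x).
  by apply: measurable_funD => //; exact: measurable_funM.
have mfphi : measurable_fun [set: R] (fun x => f (r + k * x)).
  exact: measurableT_comp.
apply/integrableP; split.
  by apply/measurable_EFinP; exact: measurable_funTS.
have [_] := integrableP _ _ _ intf.
rewrite (ge0_integral_affine r k0 mD)//; last first.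
  apply/measurable_EFinP; apply: measurable_funTS; exact: measurableT_comp.
have nk : 0 < `|k| by rewrite normr_gt0.
by rewrite -lte_pdivlMl// gt0_muley// lte_fin invr_gt0.
Qed.

(** * The trapezoid inequality *)

Lemma integrable_kernel (R : realType) (al : R) : 0 < al ->
  (@lebesgue_measure R).-integrable `[0, 1]
    (EFin \o (fun t => (1 - t) `^ al - t `^ al)).
Proof.
move=> al0; apply: measurable_bounded_integrable => //.
- by rewrite /= lebesgue_measure_itv/=; case: ifP => _; rewrite ltry.
- apply: measurable_funTS; apply: measurable_funB.
    apply: (measurableT_comp (measurable_powR _)).
    exact: measurable_funB.
  exact: measurable_powR.
- exists 1; split => // M M1 t; rewrite /= in_itv/= => /andP[t0 t1].
  have powR01 (u : R) : 0 <= u -> u <= 1 -> 0 <= u `^ al <= 1.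
    move=> u0 u1; rewrite powR_ge0/=.
    have <- : 1 `^ al = 1 :> R by rewrite powR1.
    by apply: ge0_ler_powR; rewrite ?nnegrE// ltW.
  have /andP[? ?] := powR01 _ t0 t1.
  have /andP[? ?] : 0 <= (1 - t) `^ al <= 1 by apply: powR01; lra.
  by rewrite ler_norml; apply/andP; split; lra.
Qed.

(** On [0, 1/2] the kernel is nonnegative and has an explicit primitive; the reflection t -> 1 - t
    shows that the other half contributes the same amount. *)
Lemma Rintegral_abs_kernel (R : realType) (al : R) : 0 < al ->
  \int[lebesgue_measure]_(t in `[0, 1]) `|(1 - t) `^ al - t `^ al| =
  2 / (al + 1) * (1 - 1 / 2 `^ al).
Proof.
move=> al0.
have al1 : 0 < al + 1 by rewrite addr_gt0.
set w := fun t : R => (1 - t) `^ al - t `^ al.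
have intw := integrable_kernel al0.
have intnw := integrable_norm intw.
have sub1 : (`[0, 2^-1]%classic : set R) `<=` `[0, 1]%classic.
  by move=> t; rewrite /= !in_itv/= => /andP[? ?]; apply/andP; split; lra.
have half : \int[lebesgue_measure]_(t in `[0, 2^-1]) `|w t| =
    (1 - 1 / 2 `^ al) / (al + 1).
  pose P (t : R) := - (al + 1)^-1 * ((1 - t) `^ (al + 1) + t `^ (al + 1)).
  have dP (t : R) : 0 < t < 1 -> is_derive t 1 P (w t).
    move=> /andP[t0 t1].
    have d1 := is_derive1_powR (al + 1) t0.
    have t10 : 0 < 1 - t by rewrite subr_gt0.
    have d2 : is_derive t 1 ((@powR R)^~ (al + 1) \o (fun t : R => 1 - t))
        ((al + 1) * (1 - t) `^ (al + 1 - 1) * (0 - 1)).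
      apply: is_derive1_comp; first exact: is_derive1_powR.
    apply: is_derive_eq (is_deriveZ (- (al + 1)^-1) (is_deriveD d2 d1)) _.
    by rewrite /GRing.scale/= /w addrK; field; rewrite gt_eqF.
  transitivity (P 2^-1 - P 0).
    transitivity (\int[lebesgue_measure]_(t in `[0, 2^-1]) w t).
      apply: eq_Rintegral => t; rewrite inE /= in_itv/= => /andP[t0 t2].
      rewrite ger0_norm// subr_ge0.
      by apply: ge0_ler_powR; rewrite ?nnegrE ?(ltW al0)//; lra.
    apply: integrable_derive_FTC => //.
    - by move=> t /andP[t0 t2]; apply: dP; apply/andP; split; lra.
    - apply: cvgM; first exact: cvg_cst.
      apply: cvgD; last by rewrite powR0 ?gt_eqF//; exact: powR_cvg0.
      apply: cvg_at_right_filter.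
      have d2 : is_derive (0 : R) 1 ((@powR R)^~ (al + 1) \o (fun t : R => 1 - t))
          ((al + 1) * (1 - 0) `^ (al + 1 - 1) * (0 - 1)).
        by apply: is_derive1_comp; apply: is_derive1_powR; rewrite subr0.
      exact: (is_derive_cvg d2).
    - apply/cvg_at_left_filter/(@is_derive_cvg _ _ _ (w 2^-1))/dP.
      by apply/andP; split; lra.
    - exact: integrableS intw.
  rewrite /P subr0 powR1 powR0 ?gt_eqF// (_ : 1 - 2^-1 = 2^-1); last by lra.
  have -> : (2^-1 : R) `^ (al + 1) = 2^-1 * (2 `^ al)^-1.
    rewrite powRD ?gt_eqF ?implybT// powRr1// mulrC.
    by rewrite -!powR_inv1 ?powR_ge0// powRAC.
  by field; rewrite ?gt_eqF// powR_gt0.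
have mnw (D : set R) : measurable_fun D (fun t => `|w t|%:E).
  apply/measurable_EFinP/measurable_funTS/measurableT_comp => //.
  apply: measurable_funB; last exact: measurable_powR.
  apply: (measurableT_comp (measurable_powR _)); exact: measurable_funB.
have refl : (\int[lebesgue_measure]_(t in `[2^-1%R, 1%R]) `|w t|%:E =
    \int[lebesgue_measure]_(t in `[0%R, 2^-1%R]) `|w t|%:E)%E.
  rewrite (@ge0_integral_affine R (-1) 1) ?oppr_eq0 ?oner_eq0//.
  rewrite normrN1 mul1e.
  have -> : (fun x : R => 1 + -1 * x) @^-1` `[2^-1, 1] = `[0, 2^-1]%classic.
    apply/seteqP; split => t; rewrite /= !in_itv/= => /andP[? ?].
      by apply/andP; split; lra.
    by apply/andP; split; lra.
  apply: eq_integral => t _; rewrite /w distrC; congr (`| _ `^ _ - _ `^ _|%:E); lra.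
have fin_half : (\int[lebesgue_measure]_(t in `[0%R, 2^-1%R]) `|w t|%:E)%E
    \is a fin_num.
  by apply: integrable_fin_num => //; exact: integrableS intnw.
have halfE : (\int[lebesgue_measure]_(t in `[0%R, 2^-1%R]) `|w t|%:E =
    ((1 - 1 / 2 `^ al) / (al + 1))%:E)%E.
  by rewrite -half /Rintegral fineK.
rewrite /Rintegral.
have -> : (\int[lebesgue_measure]_(t in `[0%R, 1%R]) `|w t|%:E =
    \int[lebesgue_measure]_(t in `[0%R, 2^-1%R]) `|w t|%:E +
    \int[lebesgue_measure]_(t in `[2^-1%R, 1%R]) `|w t|%:E)%E.
  rewrite -[X in (_ = _ + X)%E](integral_itv_obnd_cbnd (mnw _)).
  have -> : `[0, 1]%classic = `[0, 2^-1] `|` `]2^-1, 1] :> set R.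
    by rewrite -itv_bndbnd_setU// bnd_simp; lra.
  rewrite ge0_integral_setU//.
  - exact: mnw.
  apply/disj_setPS => t [/=]; rewrite !in_itv/= => /andP[_ ty] /andP[].
  by rewrite ltNge ty.
rewrite refl halfE -EFinD /=.
by field; rewrite ?gt_eqF// powR_gt0.
Qed.

Lemma cvg_powR_at_right (R : realType) (s a : R) : 0 < s ->
  (t - a) `^ s @[t --> a^'+] --> 0.
Proof.
move=> s0 A /(powR_cvg0 s0)[e /= e0 HA]; exists e => //= t at_e ta.
by apply: HA; rewrite /= ?subr_gt0// /ball_/= sub0r normrN distrC.
Qed.

Lemma cvg_powR_at_left (R : realType) (s b : R) : 0 < s ->
  (b - t) `^ s @[t --> b^'-] --> 0.
Proof.
move=> s0 A /(powR_cvg0 s0)[e /= e0 HA]; exists e => //= t at_e ta.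
by apply: HA; rewrite /= ?subr_gt0// /ball_/= sub0r normrN.
Qed.

Lemma is_derive_powR_subr (R : realType) (s a t : R) : a < t ->
  is_derive t 1 (fun t => (t - a) `^ s) (s * (t - a) `^ (s - 1)).
Proof.
move=> ta; have ta0 : 0 < t - a by rewrite subr_gt0.
have d1 : is_derive t 1 (fun t : R => t - a) (1 - 0).
  exact: is_deriveB (is_derive_id _ _) (is_derive_cst _ _ _).
apply: is_derive_eq (@is_derive1_comp _ (@powR R ^~ s) _ _ _ _ _ d1) _.
  exact: is_derive1_powR.
by rewrite subr0 mulr1.
Qed.

Lemma is_derive_powR_subl (R : realType) (s b t : R) : t < b ->
  is_derive t 1 (fun t => (b - t) `^ s) (- (s * (b - t) `^ (s - 1))).
Proof.
move=> tb; have tb0 : 0 < b - t by rewrite subr_gt0.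
have d1 : is_derive t 1 (fun t : R => b - t) (0 - 1).
  exact: is_deriveB (is_derive_cst _ _ _) (is_derive_id _ _).
apply: is_derive_eq (@is_derive1_comp _ (@powR R ^~ s) _ _ _ _ _ d1) _.
  exact: is_derive1_powR.
by rewrite sub0r mulrN1.
Qed.

(** For [al < 1] the kernels [p1] and [p2] are unbounded at one end each. They are affine images of
    [t^(al - 1)] on [0, c], hence integrable, and remain so after multiplication by the bounded
    function [f]. Likewise [W] is bounded, so its product with the derivative is integrable. *)
Lemma riemann_liouville_trapezoid (R : realType) (f : R -> R) (a c al : R) :
  0 < c -> 0 < al ->
  (forall x, a <= x <= a + c -> derivable f x 1) ->
  (@lebesgue_measure R).-integrable `[a, a + c] (EFin \o f^`()) ->
  f a + f (a + c) - Gamma (al + 1) / c `^ al *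
    (RL_plus al a f (a + c) + RL_minus al (a + c) f a) =
  (c `^ al)^-1 * \int[lebesgue_measure]_(t in `[a, a + c])
    (((t - a) `^ al - (a + c - t) `^ al) * derive1 f t).
Proof.
move=> c0 al0 df intf'.
have aac : a < a + c by rewrite ltrDl.
have ca0 : 0 < c `^ al by exact: powR_gt0.
pose W (t : R) := (t - a) `^ al - (a + c - t) `^ al.
pose p1 (t : R) := (a + c - t) `^ (al - 1).
pose p2 (t : R) := (t - a) `^ (al - 1).
have mI : measurable (`[a, a + c]%classic : set R) by exact: measurable_itv.
have isdf t : a <= t <= a + c -> is_derive t 1 f (derive1 f t).
  by move=> tac; split; [exact: df|rewrite derive1E].
have cf : {within `[a, a + c], continuous f}.
  by apply: derivable_within_continuous => t; rewrite in_itv; exact: df.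
have mf : measurable_fun `[a, a + c] f by exact: subspace_continuous_measurable_fun.
have bf : [bounded f x | x in `[a, a + c]%classic].
  have [M1 _ HM1] := EVT_max (ltW aac) cf.
  have [M2 _ HM2] := EVT_min (ltW aac) cf.
  exists (`|f M1| + `|f M2|); split => // M HM t /= tI.
  have := HM1 t tI; have := HM2 t tI; have := ler_norm (f M1).
  have := ler_norm (- f M2); rewrite normrN => ? ? ? ?.
  have := normr_ge0 (f M1); have := normr_ge0 (f M2) => ? ?.
  by rewrite ler_norml; apply/andP; split; lra.
have mpow (s : R) : measurable_fun [set: R] (fun t => t `^ s).
  exact: measurable_powR.
have mpl s : measurable_fun [set: R] (fun t => (t - a) `^ s).
  apply: (measurableT_comp (mpow s)); exact: measurable_funB.
have mpr s : measurable_fun [set: R] (fun t => (a + c - t) `^ s).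
  apply: (measurableT_comp (mpow s)); exact: measurable_funB.
have int0 := integrable_powRB1 al0 c0.
have int1 : (@lebesgue_measure R).-integrable `[a, a + c] (EFin \o p1).
  have m10 : (-1 : R) != 0 by rewrite oppr_eq0 oner_eq0.
  have := @integrable_affine R (-1) (a + c) _ _ m10 (measurable_itv _)
    (mpow _) int0.
  rewrite (_ : _ @^-1` _ = `[a, a + c]%classic); last first.
    apply/seteqP; split => t; rewrite /= !in_itv/= => /andP[? ?];
      by apply/andP; split; lra.
  apply: eq_integrable => // t _ /=; congr (_ `^ _)%:E; lra.
have int2 : (@lebesgue_measure R).-integrable `[a, a + c] (EFin \o p2).
  have := @integrable_affine R 1 (- a) _ _ (oner_neq0 R) (measurable_itv _)
    (mpow _) int0.
  rewrite (_ : _ @^-1` _ = `[a, a + c]%classic); last first.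
    apply/seteqP; split => t; rewrite /= !in_itv/= => /andP[? ?];
      by apply/andP; split; lra.
  apply: eq_integrable => // t _ /=; congr (_ `^ _)%:E; lra.
have int1f : (@lebesgue_measure R).-integrable `[a, a + c]
    (EFin \o (fun t => p1 t * f t)).
  rewrite (_ : EFin \o _ = (EFin \o f) \* (EFin \o p1))%E//.
    exact: integrableMr.
  by apply/funext => t; rewrite /= mulrC.
have int2f : (@lebesgue_measure R).-integrable `[a, a + c]
    (EFin \o (fun t => p2 t * f t)).
  rewrite (_ : EFin \o _ = (EFin \o f) \* (EFin \o p2))%E//.
    exact: integrableMr.
  by apply/funext => t; rewrite /= mulrC.
have bW : [bounded W x | x in `[a, a + c]%classic].
  exists (c `^ al); split => // M HM t /=; rewrite in_itv/= => /andP[at_ tac].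
  have h1 : (t - a) `^ al <= c `^ al.
    by apply: ge0_ler_powR; rewrite ?nnegrE ?(ltW al0)//; lra.
  have h2 : (a + c - t) `^ al <= c `^ al.
    by apply: ge0_ler_powR; rewrite ?nnegrE ?(ltW al0)//; lra.
  have := powR_ge0 (t - a) al; have := powR_ge0 (a + c - t) al => ? ?.
  by rewrite ler_norml /W; apply/andP; split; lra.
have mW : measurable_fun `[a, a + c] W.
  by apply: measurable_funTS; exact: measurable_funB.
have intW : (@lebesgue_measure R).-integrable `[a, a + c]
    (EFin \o (fun t => W t * derive1 f t)).
  rewrite (_ : EFin \o _ = (EFin \o W) \* (EFin \o derive1 f))%E//.
  exact: integrableMr.
have intZ1 : (@lebesgue_measure R).-integrable `[a, a + c]
    (EFin \o (fun t => al * (p1 t * f t))).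
  rewrite (_ : EFin \o _ = (fun t => al%:E * (p1 t * f t)%:E)%E) //.
  exact: integrableZl.
have intZ2 : (@lebesgue_measure R).-integrable `[a, a + c]
    (EFin \o (fun t => al * (p2 t * f t))).
  rewrite (_ : EFin \o _ = (fun t => al%:E * (p2 t * f t)%:E)%E) //.
  exact: integrableZl.
have intZ12 : (@lebesgue_measure R).-integrable `[a, a + c]
    (EFin \o (fun t => al * (p1 t * f t) + al * (p2 t * f t))).
  rewrite (_ : EFin \o _ = (EFin \o (fun t => al * (p1 t * f t))%R) \+
    (EFin \o (fun t => al * (p2 t * f t))%R))%E//.
  exact: integrableD.
(* [W] goes from [- c^al] at [a] to [c^al] at [a + c]; this change of sign turns the difference of
   boundary values into the sum [f a + f (a + c)]. *)
pose H t := W t * f t.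
have FTC : \int[lebesgue_measure]_(t in `[a, a + c])
    (al * (p1 t * f t) + al * (p2 t * f t) + W t * derive1 f t) = H (a + c) - H a.
  apply: integrable_derive_FTC => //.
  - move=> t /andP[at_ tac].
    have dt : is_derive t 1 f (derive1 f t) by apply: isdf; rewrite !ltW.
    have dW := is_deriveB (is_derive_powR_subr al at_) (is_derive_powR_subl al tac).
    apply: is_derive_eq (is_deriveM dW dt) _.
    by rewrite /GRing.scale/= /p1 /p2 /W !fctE; ring.
  - apply: cvgM.
      rewrite /W subrr powR0 ?gt_eqF//.
      apply: cvgB; first exact: cvg_powR_at_right.
      apply: cvg_at_right_filter.
      exact: (is_derive_cvg (is_derive_powR_subl al aac)).
    apply: cvg_at_right_filter.
    by apply: is_derive_cvg (isdf a _); rewrite lexx ltW.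
  - apply: cvgM.
      rewrite /W subrr powR0 ?gt_eqF//.
      apply: cvgB; last exact: cvg_powR_at_left.
      apply: cvg_at_left_filter.
      exact: (is_derive_cvg (is_derive_powR_subr al aac)).
    apply: cvg_at_left_filter.
    by apply: is_derive_cvg (isdf (a + c) _); rewrite lexx ltW.
  - rewrite (_ : EFin \o _ = (EFin \o (fun t =>
      al * (p1 t * f t) + al * (p2 t * f t))%R) \+
      (EFin \o (fun t => W t * derive1 f t)%R))%E//.
    exact: integrableD.
have H1 : H (a + c) = c `^ al * f (a + c).
  by rewrite /H /W subrr powR0 ?gt_eqF// subr0 addrAC subrr add0r.
have H0 : H a = - (c `^ al * f a).
  by rewrite /H /W subrr powR0 ?gt_eqF// sub0r addrAC subrr add0r mulNr.
rewrite RintegralD// RintegralD// !RintegralZl// H1 H0 in FTC.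
rewrite /RL_plus /RL_minus GammaS//.
have G0 : Gamma al != 0 by rewrite gt_eqF// Gamma_gt0.
pose I1 := \int[lebesgue_measure]_(t in `[a, a + c])
  ((a + c - t) `^ (al - 1) * f t).
pose I2 := \int[lebesgue_measure]_(t in `[a, a + c]) ((t - a) `^ (al - 1) * f t).
rewrite -/I1 -/I2; set J := (X in _ = _ * X).
have {}FTC : al * I1 + al * I2 + J = c `^ al * f (a + c) - - (c `^ al * f a).
  exact: FTC.
have -> : J = c `^ al * (f a + f (a + c)) - al * (I1 + I2) by lra.
by field; rewrite G0 (gt_eqF ca0).
Qed.

(** The substitution t -> a + c t contributes one factor [c] as Jacobian and one factor [c^al] from
    the homogeneity of the kernel. Since the kernel is invariant under t -> 1 - t, the terms with
    [h (1 - t)] and [h t] have the same integral, whence the sum [A + B]. *)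
Lemma le_integral_kernel_convex (R : realType) (a c al A B q : R)
    (h g : R -> R) :
  0 < c -> 0 < al -> 0 <= A -> 0 <= B ->
  (forall t : R, 0 <= t <= 1 -> 0 <= h t) ->
  (@lebesgue_measure R).-integrable `[0, 1]
    (fun t : R => (`|(1 - t) `^ al - t `^ al| * h t)%:E) ->
  measurable_fun `[a, a + c] g ->
  (forall t : R, 0 <= t <= 1 ->
    `|g (a + t * c)| `^ q <= h (1 - t) * A + h t * B) ->
  (\int[lebesgue_measure]_(t in `[a, (a + c)%R])
     (`|(t - a) `^ al - (a + c - t) `^ al| * `|g t| `^ q)%R%:E <=
   (c * c `^ al * ((A + B) * \int[lebesgue_measure]_(t in `[0, 1])
     (`|(1 - t) `^ al - t `^ al| * h t)))%R%:E)%E.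
Proof.
move=> c0 al0 A0 B0 h0 inth mg gh.
have cn0 : c != 0 by rewrite gt_eqF.
have ca0 : 0 < c `^ al by exact: powR_gt0.
pose w (t : R) : R := `|(1 - t) `^ al - t `^ al|.
pose H := \int[lebesgue_measure]_(t in `[0, 1]) (w t * h t).
have H0 : (\int[lebesgue_measure]_(t in `[0%R, 1%R]) (w t * h t)%:E = H%:E)%E.
  by rewrite /H /Rintegral fineK//; exact: integrable_fin_num inth.
have wh0 (t : R) : 0 <= t <= 1 -> 0 <= w t * h t.
  by move=> /h0; apply: mulr_ge0; exact: normr_ge0.
have wC (t : R) : w (1 - t) = w t by rewrite /w distrC subKr.
have mwh := measurable_int _ inth.
have preI : (fun x : R => 1 + -1 * x) @^-1` `[0, 1] = `[0, 1]%classic.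
  by apply/seteqP; split => t; rewrite /= !in_itv/= => /andP[? ?];
    apply/andP; split; lra.
have HC : (\int[lebesgue_measure]_(t in `[0%R, 1%R])
    (w t * h (1 - t)%R)%R%:E = H%:E)%E.
  rewrite -H0 [RHS](@ge0_integral_affine R (-1) 1) ?oppr_eq0 ?oner_eq0//.
  rewrite normrN1 mul1e preI; apply: eq_integral => t _.
  by rewrite mulN1r wC.
have mwhC : measurable_fun (`[0, 1]%classic : set R)
    (fun t : R => (w t * h (1 - t))%:E).
  rewrite (_ : (fun t => _) =
    (fun t => (w t * h t)%:E) \o (fun t : R => 1 - t)); last first.
    by apply/funext => t /=; rewrite wC.
  apply: (measurable_comp (F := (`[0, 1]%classic : set R))) => //.
    move=> _ [t + <-]; rewrite /= !in_itv/= => /andP[? ?].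
    by apply/andP; split; lra.
  exact: measurable_funB.
have mW : measurable_fun (`[a, a + c]%classic : set R)
    (fun t : R => (`|(t - a) `^ al - (a + c - t) `^ al| * `|g t| `^ q)%:E).
  apply/measurable_EFinP/measurable_funM.
    apply: measurableT_comp => //; apply: measurable_funTS.
    apply: measurable_funB; apply: (measurableT_comp (measurable_powR _));
      exact: measurable_funB.
  apply: (measurableT_comp (measurable_powR _)); exact: measurableT_comp.
rewrite (ge0_integral_affine a cn0)//.
have -> : (fun x : R => a + c * x) @^-1` `[a, a + c] = `[0, 1]%classic.
  apply/seteqP; split => t; rewrite /= !in_itv/= => /andP[? ?];
    by apply/andP; split; nra.
rewrite gtr0_norm// -mulrA EFinM lee_pmul2l//.
apply: (@le_trans _ _ (\int[lebesgue_measure]_(t in `[0%R, 1%R])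
   ((c `^ al * A)%:E * (w t * h (1 - t)%R)%R%:E +
    (c `^ al * B)%:E * (w t * h t)%R%:E))%E).
  apply: ge0_le_integral => //.
  - apply: (measurable_comp (F := (`[a, a + c]%classic : set R)) _ _ mW) => //.
      move=> _ [t + <-]; rewrite /= !in_itv/= => /andP[? ?].
      by apply/andP; split; nra.
    by apply: measurable_funD => //; exact: measurable_funM.
  - by apply: emeasurable_funD; exact: measurable_funeM.
  - move=> t; rewrite /= in_itv/= => t01; have /andP[t0 t1] := t01.
    rewrite -!EFinM -EFinD lee_fin.
    have -> : a + c - (a + c * t) = c * (1 - t) by ring.
    have -> : a + c * t - a = c * t by ring.
    rewrite !powRM ?subr_ge0 ?(ltW c0)// -mulrBr normrM gtr0_norm//.
    rewrite distrC -/(w t) [c * t]mulrC.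
    apply: le_trans (ler_wpM2l _ (gh _ t01)) _.
      exact: mulr_ge0 (ltW ca0) (normr_ge0 _).
    by rewrite le_eqVlt; apply/orP; left; apply/eqP; ring.
have in01 (t : R) : `[0, 1]%classic t -> 0 <= t <= 1 by rewrite /= in_itv.
have whC0 (t : R) : 0 <= t <= 1 -> 0 <= w t * h (1 - t).
  move=> /andP[t0 t1]; rewrite -wC; apply: wh0; apply/andP; split; lra.
have cA0 : 0 <= c `^ al * A by rewrite mulr_ge0// ltW.
have cB0 : 0 <= c `^ al * B by rewrite mulr_ge0// ltW.
rewrite ge0_integralD//; last 4 first.
- by move=> t /in01 /whC0 ?; rewrite -EFinM lee_fin mulr_ge0.
- exact: measurable_funeM.
- by move=> t /in01 /wh0 ?; rewrite -EFinM lee_fin mulr_ge0.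
- exact: measurable_funeM.
rewrite !ge0_integralZl//.
rewrite HC H0 -!EFinM -EFinD lee_fin -/H.
by rewrite le_eqVlt; apply/orP; left; apply/eqP; ring.
Qed.

Lemma riemann_liouville_trapezoid_le (R : realType) (f : R -> R)
    (a c al A B p q : R) (h : R -> R) :
  0 < c -> 0 < al -> 0 < p -> 0 < q -> p^-1 + q^-1 = 1 -> 0 <= A -> 0 <= B ->
  (forall x, a <= x <= a + c -> derivable f x 1) ->
  (@lebesgue_measure R).-integrable `[a, a + c] (EFin \o f^`()) ->
  (forall t : R, 0 <= t <= 1 -> 0 <= h t) ->
  (@lebesgue_measure R).-integrable `[0, 1]
    (fun t : R => (`|(1 - t) `^ al - t `^ al| * h t)%:E) ->
  (forall t : R, 0 <= t <= 1 ->
    `|derive1 f (a + t * c)| `^ q <= h (1 - t) * A + h t * B) ->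
  `| f a + f (a + c) - Gamma (al + 1) / c `^ al *
    (RL_plus al a f (a + c) + RL_minus al (a + c) f a) | <=
  (2 / (al + 1) * (1 - 1 / 2 `^ al)) `^ p^-1 * c *
  ((A + B) * \int[lebesgue_measure]_(t in `[0, 1])
    (`|(1 - t) `^ al - t `^ al| * h t)) `^ q^-1.
Proof.
move=> c0 al0 p0 q0 pq A0 B0 df intf h0 inth f'h.
rewrite riemann_liouville_trapezoid//.
have cn0 : c != 0 by rewrite gt_eqF.
have ca0 : 0 < c `^ al by exact: powR_gt0.
pose W (t : R) : R := (t - a) `^ al - (a + c - t) `^ al.
pose w (t : R) : R := `|(1 - t) `^ al - t `^ al|.
pose K := 2 / (al + 1) * (1 - 1 / 2 `^ al).
pose H := \int[lebesgue_measure]_(t in `[0, 1]) (w t * h t).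
have KE : (\int[lebesgue_measure]_(t in `[0%R, 1%R]) (w t)%:E = K%:E)%E.
  rewrite /K -Rintegral_abs_kernel// /Rintegral fineK//.
  exact: integrable_fin_num (integrable_norm (integrable_kernel al0)).
have K0 : 0 <= K.
  by rewrite -lee_fin -KE; apply: integral_ge0 => t _; rewrite lee_fin normr_ge0.
have H0 : 0 <= H.
  apply: Rintegral_ge0 => t; rewrite /= in_itv/= => /h0.
  by apply: mulr_ge0; exact: normr_ge0.
have mW (D : set R) : measurable_fun D W.
  apply: measurable_funTS; apply: measurable_funB;
    apply: (measurableT_comp (measurable_powR _)); exact: measurable_funB.
have mf' : measurable_fun `[a, a + c] (derive1 f).
  by apply/measurable_EFinP; exact: measurable_int intf.
have WE : (\int[lebesgue_measure]_(t in `[a, (a + c)%R]) `|W t|%:E =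
    (c * c `^ al * K)%:E)%E.
  rewrite (ge0_integral_affine a cn0)//; last first.
    by apply/measurable_EFinP; exact: measurableT_comp.
  have -> : (fun x : R => a + c * x) @^-1` `[a, a + c] = `[0, 1]%classic.
    apply/seteqP; split => t; rewrite /= !in_itv/= => /andP[? ?];
      by apply/andP; split; nra.
  rewrite gtr0_norm// -mulrA EFinM; congr (_ * _)%E.
  rewrite EFinM -KE -ge0_integralZl//; last 3 first.
  - apply/measurable_EFinP/measurableT_comp => //; apply: measurable_funTS.
    apply: measurable_funB; apply: (measurableT_comp (measurable_powR _)) => //.
    exact: measurable_funB.
  - by move=> t _; rewrite lee_fin normr_ge0.
  - by rewrite lee_fin ltW.
  apply: eq_integral => t; rewrite inE/= in_itv/= => /andP[t0 t1].
  rewrite -EFinM /W; congr (_%:E).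
  have -> : a + c - (a + c * t) = c * (1 - t) by ring.
  have -> : a + c * t - a = c * t by ring.
  rewrite !powRM ?subr_ge0 ?(ltW c0)// -mulrBr normrM gtr0_norm//.
  by rewrite distrC.
have mnW : measurable_fun `[a, a + c] (fun t => `|W t|) by exact: measurableT_comp.
have mnf : measurable_fun `[a, a + c] (fun t => `|derive1 f t|).
  exact: measurableT_comp.
have hold : (\int[lebesgue_measure]_(t in `[a, (a + c)%R])
    (`|W t| * `|derive1 f t|)%R%:E <=
    ((c * c `^ al * K) `^ p^-1 *
     (c * c `^ al * ((A + B) * H)) `^ q^-1)%R%:E)%E.
  have := @weighted_hoelder _ (measurableTypeR R) R lebesgue_measure
    _ _ _ p q (measurable_itv _) mnW mnf
    (fun _ _ => normr_ge0 _) (fun _ _ => normr_ge0 _) p0 q0 pq.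
  move=> /le_trans; apply.
  rewrite WE [leRHS]EFinM -!poweR_EFin; apply: lee_wpmul2l; first exact: poweR_ge0.
  apply: gt0_ler_poweR; rewrite ?in_itv/= ?invr_ge0 ?(ltW q0) ?lee_fin//.
  - rewrite leey andbT; apply: integral_ge0 => t _.
    by rewrite lee_fin mulr_ge0 ?powR_ge0.
  - by rewrite leey andbT !mulr_ge0 ?addr_ge0// ltW.
  exact: le_integral_kernel_convex.
(* Finiteness of the Hoelder bound also provides the integrability that allows the absolute value to
   be moved under the integral. *)
have intWf : (@lebesgue_measure R).-integrable `[a, a + c]
    (EFin \o (fun t => W t * derive1 f t)).
  apply/integrableP; split.
    by apply/measurable_EFinP; apply: measurable_funM => //; exact: mW.
  under eq_integral do rewrite /= normrM.
  by apply: le_lt_trans hold _; rewrite ltry.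
rewrite normrM gtr0_norm ?invr_gt0//.
have {}hold : `|\int[lebesgue_measure]_(t in `[a, a + c]) (W t * derive1 f t)| <=
    (c * c `^ al * K) `^ p^-1 * (c * c `^ al * ((A + B) * H)) `^ q^-1.
  apply: (le_trans (le_normr_Rintegral _ intWf)) => //.
  rewrite -lee_fin /Rintegral fineK; last first.
    exact: integrable_fin_num (integrable_norm intWf).
  by under eq_integral do rewrite /= normrM.
rewrite ler_pdivrMl//; apply: (le_trans hold).
rewrite -/K -/(w _) -/H.
(* Each Hoelder factor contains [c * c^al], with exponents [1/p] and [1/q]. They recombine to
   exactly [c * c^al], and [c^al] cancels against the prefactor of the integral. *)
have cca0 : 0 <= c * c `^ al by rewrite mulr_ge0 ?ltW.
have AB0 : 0 <= (A + B) * H by rewrite mulr_ge0 ?addr_ge0.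
rewrite (powRM _ cca0 K0) (powRM _ cca0 AB0) mulrACA -powRD; last first.
  by rewrite pq oner_eq0.
rewrite pq powRr1// -/H le_eqVlt; apply/orP; left; apply/eqP; ring.
Qed.

Theorem theorem3 (R : realType) (phi : R) (I : set R) (eta : R -> R -> R)
    (a b c : R) (f : R -> R) (J : set R) (h : R -> R) (alpha p q : R)
    (hphi : 0 <= phi <= pi / 2)
    (Iopen : open I)
    (Iinvex : phi_invex phi eta I)
    (Ia : I a) (Ib : I b)
    (eta_gt0 : 0 < eta b a)
    (cE : c%:C = expi phi * (eta b a)%:C)
    (fdiff : forall x : R, I x -> derivable f x 1)
    (f'L1 : (@lebesgue_measure R).-integrable `[a, a + c] (EFin \o f^`()))
    (alpha_gt0 : 0 < alpha)
    (q_gt1 : 1 < q)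
    (pq : 1 / p + 1 / q = 1)
    (J01 : `[0, 1] `<=` J)
    (h_ge0 : forall t : R, J t -> 0 <= h t)
    (hint : (@lebesgue_measure R).-integrable `[0, 1]
      (fun t : R => (`|(1 - t) `^ alpha - t `^ alpha| * h t)%:E))
    (f'preinvex : h_phi_preinvex phi eta h I (fun x : R => `|f^`() x| `^ q)) :
  `| f a + f (a + c)
     - Gamma (alpha + 1) / c `^ alpha
       * (RL_plus alpha a f (a + c) + RL_minus alpha (a + c) f a) |
  <= (2 / (alpha + 1)) `^ (1 / p) * (1 - 1 / 2 `^ alpha) `^ (1 / p) * c
     * ((`|f^`() a| `^ (p / (p - 1)) + `|f^`() b| `^ (p / (p - 1)))
        * \int[@lebesgue_measure R]_(t in `[0, 1])
            (`|(1 - t) `^ alpha - t `^ alpha| * h t)) `^ ((p - 1) / p).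
Proof.
have [sphi cphi] : sin phi = 0 /\ c = cos phi * eta b a.
  move: cE => /eqP; rewrite /expi eq_complex/= => /andP[/eqP re /eqP im].
  split; last by rewrite re; ring.
  apply/eqP; have /eqP : sin phi * eta b a = 0 by rewrite im; ring.
  by rewrite mulf_eq0 (gt_eqF eta_gt0) orbF.
(* A vanishing sine forces the cosine to be 1 or -1, and the range of [phi] leaves only 1. *)
have c0 : 0 < c.
  have cphi0 : 0 <= cos phi.
    apply: cos_ge0_pihalf; move: hphi => /andP[? ->]; rewrite andbT.
    by have := pi_gt0 R; lra.
  by rewrite cphi -(ger0_norm cphi0) sin0cos1// mul1r.
have q0 : 0 < q by exact: lt_trans q_gt1.
have pqV : p^-1 + q^-1 = 1 by rewrite -pq !div1r.
(* The sign of [p] follows from [1/p = 1 - 1/q > 0]; the case [p = 0] is excluded as well, the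
   inverse of 0 being 0. *)
have p0 : 0 < p.
  by rewrite -invr_gt0 (_ : p^-1 = 1 - q^-1) ?subr_gt0 ?invf_lt1// -pqV addrK.
have pI : (p - 1) / p = q^-1.
  by rewrite mulrBl divff ?gt_eqF// mul1r -pqV addrAC subrr add0r.
have qE : p / (p - 1) = q by rewrite -[RHS]invrK -pI invf_div.
have pathE t : phi_path phi eta a b t = (a + t * c)%:C.
  by rewrite /phi_path -mulrA -cE -rmorphM -rmorphD.
have seg t : 0 <= t <= 1 -> I (a + t * c).
  by move=> t01; have [x Ix] := Iinvex a b t Ia Ib t01; rewrite pathE => -[->].
(* Merging the two powers with exponent [1/p] requires both bases to be nonnegative; for the second
   this is [2^alpha >= 1]. *)
rewrite -powRM; last 2 first.
- by rewrite divr_ge0// addr_ge0// ltW.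
- rewrite div1r subr_ge0 invf_le1 ?powR_gt0//.
  have two1 : 1 <= 2 :> R by lra.
  by have := ler_powR two1 (ltW alpha_gt0); rewrite powRr0.
rewrite pI qE (div1r p); apply: riemann_liouville_trapezoid_le => //.
- move=> x /andP[ax xc]; apply: fdiff.
  rewrite (_ : x = a + (x - a) / c * c); last by rewrite divfK ?gt_eqF// subrKC.
  apply: seg; rewrite divr_ge0 ?(ltW c0) ?subr_ge0//= ler_pdivrMr// mul1r; lra.
- by move=> t t01; apply/h_ge0/J01; rewrite /= in_itv.
- move=> t t01; exact: (f'preinvex a b t _ Ia Ib t01 (pathE t)).
Qed.
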